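(* Let $t>0$ and $0<u<1$ (with $u\ne\frac12$ in the formula for $\theta_2$). Then $$\frac{\frac{\partial\theta_4}{\partial u}(u,t)}{\theta_4(u,t)}=2\sum_{k\ge0}\frac{\pi\sin(2\pi u)}{\cosh(2k\pi^2t+\pi^2t)-\cos(2\pi u)},$$ $$\frac{\frac{\partial\theta_3}{\partial u}(u,t)}{\theta_3(u,t)}=-2\sum_{k\ge0}\frac{\pi\sin(2\pi u)}{\cosh(2k\pi^2t+\pi^2t)+\cos(2\pi u)},$$ $$\frac{\frac{\partial\theta_1}{\partial u}(u,t)}{\theta_1(u,t)}=\pi\cot(\pi u)+2\pi\sum_{k\ge1}\frac{\sin(2\pi u)}{\cosh(2k\pi^2t)-\cos(2\pi u)},$$ $$\frac{\frac{\partial\theta_2}{\partial u}(u,t)}{\theta_2(u,t)}=-\pi\tan(\pi u)-2\pi\sum_{k\ge1}\frac{\sin(2\pi u)}{\cosh(2k\pi^2t)+\cos(2\pi u)}.$$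
   Context: For $t>0$ put $\tau=i\pi t$ and $q=e^{i\pi\tau}=e^{-\pi^2 t}$. The Jacobi theta functions, as functions of $u$ and $t>0$, are $$\theta_1(u,t)=2\sum_{n\ge0}(-1)^n q^{(n+1/2)^2}\sin((2n+1)\pi u),\qquad \theta_2(u,t)=2\sum_{n\ge0}q^{(n+1/2)^2}\cos((2n+1)\pi u),$$ $$\theta_3(u,t)=1+2\sum_{n\ge1}q^{n^2}\cos(2n\pi u),\qquad \theta_4(u,t)=1+2\sum_{n\ge1}(-1)^nq^{n^2}\cos(2n\pi u).$$ *)

(* Defs.v *)
From Stdlib Require Import Reals.
From Coquelicot Require Import Coquelicot.
Open Scope R_scope.

(* The nome e^(i pi tau) for tau = i pi t; it is real and lies in (0,1)
   when t > 0. *)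
Definition nome (t : R) : R := exp (- (PI ^ 2 * t)).

(* [Rpower] is the genuine real power here, since [nome t] is positive. *)
Definition theta1 (u t : R) : R :=
  2 * Series (fun n : nat =>
    (-1) ^ n * Rpower (nome t) ((INR n + 1 / 2) ^ 2)
      * sin ((2 * INR n + 1) * PI * u)).

Definition theta2 (u t : R) : R :=
  2 * Series (fun n : nat =>
    Rpower (nome t) ((INR n + 1 / 2) ^ 2)
      * cos ((2 * INR n + 1) * PI * u)).

(* [Series] starts at index 0, so a sum over n >= 1 is written with [S n]. *)
Definition theta3 (u t : R) : R :=
  1 + 2 * Series (fun n : nat =>
    nome t ^ (S n * S n)%nat * cos (2 * INR (S n) * PI * u)).

Definition theta4 (u t : R) : R :=
  1 + 2 * Series (fun n : nat =>
    (-1) ^ S n * nome t ^ (S n * S n)%nat * cos (2 * INR (S n) * PI * u)).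

Definition cot (x : R) : R := cos x / sin x.

(* Main.v *)
Require Import Defs.
From Stdlib Require Import Reals Lra Lia.
From Coquelicot Require Import Coquelicot.
Open Scope R_scope.

(** Put [c = PI^2 t], [q = exp (- c)], [r = q^2].  The formulas are the
    logarithmic derivatives of the product expansions of the theta functions,
    and these products come from the finite form of the Jacobi triple product.
    The Gauss sum

      G_n(x) = sum_(k <= n) [n choose k]_r q^((k - n/2)^2) cos((2k - n) x)

    satisfies G_(n+2)(x) = G_n(x) (1 + 2 q^(n+1) cos 2x + q^(2n+2))
    ([gauss_sum_step2]), by two applications of the q-Pascal rule.  Folding
    the sum around its centre ([gauss_sum_fold]) turns G_(2N+p), p = 0 or 1,
    into a cosine polynomial whose j-th coefficient is that of theta_3 (p = 0)
    or theta_2 (p = 1), times a central q-binomial coefficient.  Those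
    q-binomials are bounded and tend to 1/L, where L is the infinite product
    of the 1 - r^k, so dominated convergence ([tannery]) gives
    G_(2N+p) -> theta / L and G_(2N+p)' -> theta' / L.

    On the other hand, by the recursion, G_(2N+p)'/G_(2N+p) is
    - p tan(p x) minus twice the sum of the first N terms
    sin 2x / (cosh(c (2k+p+1)) + cos 2x).  Hence the convergence of the series
    and its value both come from taking the limit of this quotient, once
    theta(x) is known to be nonzero.  This holds because each factor of the
    product is at least (1 - q^k)^2, and the product of the 1 - q^k is bounded
    below by a positive constant ([qfact_lower]).

    Finally theta_4 and theta_1 are theta_3 and theta_2 translated by half a
    unit in [u], so that two cases (p = 0, 1) yield the four formulas. *)

(** * q-factorials and q-binomial coefficients *)

Lemma exp_le_exp a b : a <= b -> exp a <= exp b.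
Proof. intros [h|h]; [left; now apply exp_increasing | subst; lra]. Qed.

Fixpoint qfact (r : R) (n : nat) : R :=
  match n with
  | O => 1
  | S m => qfact r m * (1 - r ^ S m)
  end.

Definition qbinom (r : R) (n k : nat) : R :=
  if (k <=? n)%nat then qfact r n / (qfact r k * qfact r (n - k)) else 0.

Lemma pow_S_in_unit r n : 0 < r < 1 -> 0 < r ^ S n < 1.
Proof.
intros [h0 h1]; split; [now apply pow_lt|].
apply pow_lt_1_compat; [lra | lia].
Qed.

Lemma qfact_pos r n : 0 < r < 1 -> 0 < qfact r n.
Proof.
intros hr; induction n as [|n IH]; [simpl; lra|].
apply Rmult_lt_0_compat; [exact IH|].
generalize (pow_S_in_unit r n hr); lra.
Qed.

Lemma qfact_decr r n : 0 < r < 1 -> qfact r (S n) <= qfact r n.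
Proof.
intros hr.
generalize (qfact_pos r n hr) (pow_S_in_unit r n hr); intros h1 h2.
change (qfact r (S n)) with (qfact r n * (1 - r ^ S n)); nra.
Qed.

Lemma qfact_le_1 r n : 0 < r < 1 -> qfact r n <= 1.
Proof.
intros hr; induction n as [|n IH]; [simpl; lra|].
generalize (qfact_decr r n hr); lra.
Qed.

(** From 1/(1 - x) = 1 + x/(1 - x) <= 1 + x/(1 - rho) <= exp(x/(1 - rho)), by
    taking inverses. *)
Lemma exp_le_1_sub x rho : 0 <= x <= rho -> rho < 1 ->
  exp (- (x / (1 - rho))) <= 1 - x.
Proof.
intros [h0 h1] h2.
assert (h3 : / (1 - x) <= exp (x / (1 - rho))).
{ apply Rle_trans with (1 + x / (1 - rho)).
  - replace (/ (1 - x)) with (1 + x / (1 - x)) by (field; lra).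
    apply Rplus_le_compat_l, Rmult_le_compat_l; [exact h0|].
    apply Rinv_le_contravar; lra.
  - apply exp_ineq1_le. }
rewrite exp_Ropp.
rewrite <- (Rinv_inv (1 - x)).
apply Rinv_le_contravar; [apply Rinv_0_lt_compat; lra | exact h3].
Qed.

(** A lower bound for the infinite product of the [1 - r^k]: by
    [exp_le_1_sub] with [rho = r] it is at least the exponential of
    minus the geometric series of ratio [r], divided by [1 - r]. *)
Definition qfact_floor (r : R) : R := exp (- (r / (1 - r) / (1 - r))).

Lemma qfact_lower r n : 0 < r < 1 -> qfact_floor r <= qfact r n.
Proof.
intros hr.
assert (h : exp (- (r * (1 - r ^ n) / (1 - r) / (1 - r))) <= qfact r n).
{ induction n as [|n IH].
  - simpl. replace (- _) with 0 by (field; lra). rewrite exp_0; lra.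
  - replace (- _) with (- (r * (1 - r ^ n) / (1 - r) / (1 - r))
                        + - (r ^ S n / (1 - r))) by (simpl; field; lra).
    rewrite exp_plus.
    apply Rmult_le_compat; try (left; apply exp_pos); [exact IH|].
    generalize (pow_S_in_unit r n hr); intros h.
    apply exp_le_1_sub; [|lra].
    split; [lra|]. simpl.
    assert (r ^ n <= 1) by (rewrite <- (pow1 n); apply pow_incr; lra).
    assert (0 < r ^ n) by (apply pow_lt; lra). nra. }
refine (Rle_trans _ _ _ _ h).
apply exp_le_exp, Ropp_le_contravar.
assert (0 < r ^ n) by (apply pow_lt; lra).
unfold Rdiv; rewrite !Rmult_assoc.
assert (0 < / (1 - r)) by (apply Rinv_0_lt_compat; lra).
apply Rmult_le_compat_l; [lra|].
assert (0 < / (1 - r) * / (1 - r)) by nra. nra.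
Qed.

Lemma qfact_floor_pos r : 0 < qfact_floor r.
Proof. apply exp_pos. Qed.

Lemma qfact_lim r : 0 < r < 1 ->
  exists L, 0 < L /\ is_lim_seq (qfact r) L.
Proof.
intros hr.
destruct (ex_finite_lim_seq_decr (qfact r) (qfact_floor r)) as [L hL].
- intros n; now apply qfact_decr.
- intros n; now apply qfact_lower.
- exists L; split; [|exact hL].
  apply Rlt_le_trans with (1 := qfact_floor_pos r).
  apply (is_lim_seq_le (fun _ => qfact_floor r) (qfact r)
           (Finite (qfact_floor r)) (Finite L)); [|apply is_lim_seq_const|exact hL].
  intros n; now apply qfact_lower.
Qed.

(** The values with [m + l] on top need no natural-number subtraction;
    identities between q-binomials are proved in this form. *)
Lemma qbinom_split r m l :
  qbinom r (m + l) m = qfact r (m + l) / (qfact r m * qfact r l).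
Proof.
unfold qbinom. rewrite (proj2 (Nat.leb_le m (m + l)) ltac:(lia)).
now replace (m + l - m)%nat with l by lia.
Qed.

Lemma qbinom_gt r n k : (n < k)%nat -> qbinom r n k = 0.
Proof. intros h; unfold qbinom. now rewrite (proj2 (Nat.leb_gt k n) h). Qed.

Lemma qbinom_sym r n k : (k <= n)%nat -> qbinom r n (n - k) = qbinom r n k.
Proof.
intros h; unfold qbinom.
rewrite (proj2 (Nat.leb_le _ _) h), (proj2 (Nat.leb_le (n - k) n) ltac:(lia)).
replace (n - (n - k))%nat with k by lia.
now rewrite (Rmult_comm (qfact r k)).
Qed.

Lemma qbinom_0 r n : 0 < r < 1 -> qbinom r n 0 = 1.
Proof.
intros hr; generalize (qbinom_split r 0 n); simpl; intros ->. field.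
generalize (qfact_pos r n hr); lra.
Qed.

Lemma qbinom_diag r n : 0 < r < 1 -> qbinom r n n = 1.
Proof.
intros hr. rewrite <- (qbinom_0 r n hr), <- (qbinom_sym r n n) by lia.
now rewrite Nat.sub_diag.
Qed.

Lemma qbinom_pascal r n k : 0 < r < 1 ->
  qbinom r (S n) (S k) = qbinom r n k + r ^ S k * qbinom r n (S k).
Proof.
intros hr.
destruct (Nat.lt_trichotomy k n) as [h|[h|h]].
- destruct (Nat.le_exists_sub (S k) n h) as [d [-> _]].
  replace (S (d + S k)) with (S k + S d)%nat by lia.
  rewrite qbinom_split.
  replace (d + S k)%nat with (k + S d)%nat by lia.
  rewrite qbinom_split.
  replace (k + S d)%nat with (S k + d)%nat by lia.
  rewrite qbinom_split.
  replace (S k + S d)%nat with (S (S k + d)) by lia.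
  generalize (qfact_pos r k hr) (qfact_pos r d hr); intros h1 h2.
  generalize (pow_S_in_unit r k hr) (pow_S_in_unit r d hr); intros h3 h4.
  change (qfact r (S (S k + d)))
    with (qfact r (S k + d) * (1 - r ^ (S (S k + d)))).
  replace (S (S k + d)) with (S k + S d)%nat by lia.
  rewrite pow_add.
  change (qfact r (S k)) with (qfact r k * (1 - r ^ S k)).
  change (qfact r (S d)) with (qfact r d * (1 - r ^ S d)).
  field. lra.
- subst k. rewrite (qbinom_diag r (S n) hr), (qbinom_diag r n hr).
  rewrite (qbinom_gt r n (S n)) by lia. ring.
- rewrite !qbinom_gt by lia. ring.
Qed.

Lemma qbinom_pascal_dual r n k : 0 < r < 1 -> (k <= n)%nat ->
  qbinom r (S n) (S k) = qbinom r n (S k) + r ^ (n - k) * qbinom r n k.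
Proof.
intros hr hk.
destruct (Nat.eq_dec k n) as [->|hne].
- rewrite (qbinom_diag r (S n) hr), (qbinom_diag r n hr).
  rewrite (qbinom_gt r n (S n)), Nat.sub_diag by lia. simpl; ring.
- rewrite <- (qbinom_sym r (S n) (S k)) by lia.
  replace (S n - S k)%nat with (S (n - S k)) by lia.
  rewrite (qbinom_pascal r n _ hr).
  rewrite (qbinom_sym r n (S k)) by lia.
  replace (S (n - S k)) with (n - k)%nat by lia.
  now rewrite (qbinom_sym r n k) by lia.
Qed.

(** The form of Pascal's rule that matches the product of two conjugate factors
    (1 + q^(n+1) z) (1 + q^(n+1) / z) of the triple product: one rule
    absorbs the first factor, its mirror image the second. *)
Lemma qbinom_step2 r n k : 0 < r < 1 -> (k <= n)%nat ->
  qbinom r (S (S n)) (S (S k)) =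
    qbinom r n (S k) * (1 + r ^ S n)
    + r ^ S (S k) * qbinom r n (S (S k)) + r ^ (n - k) * qbinom r n k.
Proof.
intros hr hk.
rewrite (qbinom_pascal r (S n) (S k) hr).
rewrite (qbinom_pascal_dual r n k hr hk).
destruct (Nat.eq_dec k n) as [->|hne].
- rewrite (qbinom_gt r (S n) (S (S n))), (qbinom_gt r n (S n)),
    (qbinom_gt r n (S (S n))) by lia. ring.
- rewrite (qbinom_pascal_dual r n (S k) hr) by lia.
  replace (r ^ S n) with (r ^ S (S k) * r ^ (n - S k)).
  + ring.
  + rewrite <- pow_add; f_equal; lia.
Qed.

Lemma qbinom_bounds r n k : 0 < r < 1 ->
  0 <= qbinom r n k <= / (qfact_floor r * qfact_floor r).
Proof.
intros hr. generalize (qfact_floor_pos r); intros hf.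
assert (h0 : 0 < / (qfact_floor r * qfact_floor r))
  by (apply Rinv_0_lt_compat; nra).
unfold qbinom; destruct (k <=? n)%nat; [|lra].
generalize (qfact_pos r n hr) (qfact_pos r k hr) (qfact_pos r (n - k) hr).
generalize (qfact_le_1 r n hr) (qfact_lower r k hr) (qfact_lower r (n - k) hr).
intros h1 h2 h3 h4 h5 h6.
assert (h7 : 0 < / (qfact r k * qfact r (n - k)))
  by (apply Rinv_0_lt_compat; nra).
assert (h8 : / (qfact r k * qfact r (n - k)) <= / (qfact_floor r * qfact_floor r))
  by (apply Rinv_le_contravar; nra).
unfold Rdiv; split; nra.
Qed.

(** Writing the q-binomial as qfact(2N+p) / (qfact(N+p+j) qfact(N-j)), the three
    q-factorials all tend to [L]: the limit L / L^2 does not depend on [j]. *)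
Lemma qbinom_central_lim r L p j : 0 < r < 1 -> 0 < L -> is_lim_seq (qfact r) L ->
  is_lim_seq (fun N => qbinom r (2 * N + p) (N + p + j)) (/ L).
Proof.
intros hr hL hlim.
assert (hsub : forall phi : nat -> nat, (forall N, (N <= phi (N + j))%nat) ->
          is_lim_seq (fun N => qfact r (phi N)) L).
{ intros phi hphi. apply is_lim_seq_subseq; [|exact hlim].
  intros P [M hM]; exists (M + j)%nat; intros n hn. apply hM.
  specialize (hphi (n - j)%nat).
  replace (n - j + j)%nat with n in hphi by lia. lia. }
replace (/ L) with (L / (L * L)) by (field; lra).
apply is_lim_seq_ext_loc with
  (fun N => qfact r (2 * N + p) / (qfact r (N + p + j) * qfact r (N - j))).
- exists j; intros N hN.
  replace (2 * N + p)%nat with ((N + p + j) + (N - j))%nat by lia.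
  now rewrite qbinom_split.
- apply is_lim_seq_div'; [| |nra].
  + apply (hsub (fun N => (2 * N + p)%nat)); intros; lia.
  + apply is_lim_seq_mult'.
    * apply (hsub (fun N => (N + p + j)%nat)); intros; lia.
    * apply (hsub (fun N => (N - j)%nat)); intros; lia.
Qed.

(** * The Gauss sums and their product recursion *)

Lemma exp_pow x n : exp x ^ n = exp (INR n * x).
Proof.
induction n as [|n IH]; [now rewrite Rmult_0_l, exp_0|].
rewrite S_INR. simpl. rewrite IH, <- exp_plus. f_equal; ring.
Qed.

Lemma exp_neg_in_unit c : 0 < c -> 0 < exp (- c) < 1.
Proof.
intros hc; split; [apply exp_pos|].
rewrite <- exp_0; apply exp_increasing; lra.
Qed.

Definition gauss_coef (c : R) (n k : nat) : R :=
  qbinom (exp (- (2 * c))) n k * exp (- (c * (INR k - INR n / 2) ^ 2)).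

Definition gauss_sum (c : R) (n : nat) (x : R) : R :=
  sum_f_R0 (fun k => gauss_coef c n k * cos ((2 * INR k - INR n) * x)) n.

(** This is q^(n+1) for q = exp(-c). *)
Definition gauss_nome (c : R) (n : nat) : R := exp (- (c * (INR n + 1))).

(** Completing squares, the quotients of neighbouring Gaussian weights
    are powers of [r]; they are exactly the powers in [qbinom_step2]. *)
Lemma gauss_coef_step2 c n k : 0 < c ->
  gauss_coef c (S (S n)) (S (S k)) =
    gauss_coef c n (S k) * (1 + gauss_nome c n ^ 2)
    + gauss_nome c n * (gauss_coef c n k + gauss_coef c n (S (S k))).
Proof.
intros hc.
assert (hr : 0 < exp (- (2 * c)) < 1) by (apply exp_neg_in_unit; lra).
unfold gauss_coef.
destruct (Nat.le_gt_cases k n) as [hk|hk].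
- rewrite (qbinom_step2 _ n k hr hk).
  unfold gauss_nome. rewrite !exp_pow.
  rewrite minus_INR by exact hk. rewrite !S_INR.
  set (w := exp (- (c * (INR k + 1 - INR n / 2) ^ 2))).
  replace (exp (- (c * (INR k + 1 + 1 - (INR n + 1 + 1) / 2) ^ 2))) with w
    by (unfold w; f_equal; field).
  replace (exp ((INR 0 + 1 + 1) * - (c * (INR n + 1))))
    with (exp ((INR n + 1) * - (2 * c))) by (f_equal; simpl; ring).
  replace (exp ((INR k + 1 + 1) * - (2 * c)) ) with
    (exp (- (c * (INR n + 1))) * exp (- (c * (INR k + 1 + 1 - INR n / 2) ^ 2)) / w).
  2: { unfold w, Rdiv; rewrite <- exp_Ropp, <- !exp_plus; f_equal; field. }
  replace (exp ((INR n - INR k) * - (2 * c)) ) with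
    (exp (- (c * (INR n + 1))) * exp (- (c * (INR k - INR n / 2) ^ 2)) / w).
  2: { unfold w, Rdiv; rewrite <- exp_Ropp, <- !exp_plus; f_equal; field. }
  field. apply Rgt_not_eq, exp_pos.
- rewrite (qbinom_gt _ (S (S n))), (qbinom_gt _ n (S k)), (qbinom_gt _ n k),
    (qbinom_gt _ n (S (S k))) by lia. ring.
Qed.

Lemma gauss_coef_step2_0 c n : 0 < c ->
  gauss_coef c (S (S n)) 0 = gauss_nome c n * gauss_coef c n 0.
Proof.
intros hc.
assert (hr : 0 < exp (- (2 * c)) < 1) by (apply exp_neg_in_unit; lra).
unfold gauss_coef, gauss_nome. rewrite !qbinom_0 by exact hr.
rewrite !Rmult_1_l, <- exp_plus, !S_INR. f_equal; simpl; field.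
Qed.

Lemma gauss_coef_step2_1 c n : 0 < c ->
  gauss_coef c (S (S n)) 1 =
    gauss_coef c n 0 * (1 + gauss_nome c n ^ 2) + gauss_nome c n * gauss_coef c n 1.
Proof.
intros hc.
assert (hr : 0 < exp (- (2 * c)) < 1) by (apply exp_neg_in_unit; lra).
unfold gauss_coef, gauss_nome.
rewrite (qbinom_pascal _ (S n) 0 hr), (qbinom_pascal_dual _ n 0 hr) by lia.
rewrite !qbinom_0 by exact hr. rewrite Nat.sub_0_r, !exp_pow, !S_INR.
set (w := exp (- (c * (INR 0 - INR n / 2) ^ 2))).
replace (exp (- (c * (INR 0 + 1 - (INR n + 1 + 1) / 2) ^ 2))) with w
  by (unfold w; f_equal; field).
replace (exp ((INR 0 + 1 + 1) * - (c * (INR n + 1)))) with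
  (exp ((INR 0 + 1) * - (2 * c)) * exp (INR n * - (2 * c)))
  by (rewrite <- exp_plus; f_equal; simpl; ring).
replace (exp (- (c * (INR n + 1)))) with
  (exp ((INR 0 + 1) * - (2 * c)) * w / exp (- (c * (INR 0 + 1 - INR n / 2) ^ 2))).
2: { unfold w, Rdiv; rewrite <- exp_Ropp, <- !exp_plus; f_equal; simpl; field. }
field. apply Rgt_not_eq, exp_pos.
Qed.

(** Multiplication of polynomials by the palindromic factor
    be + al z + be z^2, with the powers of z replaced by an arbitrary sequence
    [C].  Stopping at [M] leaves boundary terms, which vanish when [a] does
    beyond [M]. *)
Lemma sum_mul_palindrome (a b C : nat -> R) (al be : R) (M : nat) :
  b 0%nat = be * a 0%nat ->
  b 1%nat = al * a 0%nat + be * a 1%nat ->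
  (forall k, b (S (S k)) = al * a (S k) + be * (a k + a (S (S k)))) ->
  a (S M) = 0 -> a (S (S M)) = 0 ->
  sum_f_R0 (fun k => a k * (be * C k + al * C (S k) + be * C (S (S k)))) M
  = sum_f_R0 (fun k => b k * C k) (S (S M)).
Proof.
intros h0 h1 h2 z1 z2.
(* Induction needs the boundary terms, as [a] need not vanish below [M]. *)
assert (h : forall m,
  sum_f_R0 (fun k => a k * (be * C k + al * C (S k) + be * C (S (S k)))) m
  + (al * a (S m) + be * a (S (S m))) * C (S (S m)) + be * a (S m) * C (S m)
  = sum_f_R0 (fun k => b k * C k) (S (S m))).
{ induction m as [|m IH].
  - simpl. rewrite h0, h1, h2. ring.
  - rewrite (tech5 (fun k => b k * C k) (S (S m))), <- IH, tech5, h2. ring. }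
rewrite <- h, z1, z2. ring.
Qed.

(** The finite triple product: 2 cos 2x times cos((2k - n) x) is the sum of the
    two neighbouring cosines, so the factor acts on the coefficients as the
    palindrome q^(n+1), 1 + q^(2n+2), q^(n+1). *)
Lemma gauss_sum_step2 c n x : 0 < c ->
  gauss_sum c (S (S n)) x =
    gauss_sum c n x * (1 + 2 * gauss_nome c n * cos (2 * x) + gauss_nome c n ^ 2).
Proof.
intros hc. unfold gauss_sum at 1.
rewrite <- (sum_mul_palindrome (gauss_coef c n) (gauss_coef c (S (S n)))
  (fun k => cos ((2 * INR k - INR (S (S n))) * x))
  (1 + gauss_nome c n ^ 2) (gauss_nome c n) n).
- unfold gauss_sum. rewrite Rmult_comm, scal_sum. apply sum_eq; intros k _.
  rewrite !S_INR.
  set (y := (2 * INR k - INR n) * x).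
  replace ((2 * INR k - (INR n + 1 + 1)) * x) with (y - 2 * x) by (unfold y; ring).
  replace ((2 * (INR k + 1) - (INR n + 1 + 1)) * x) with y by (unfold y; ring).
  replace ((2 * (INR k + 1 + 1) - (INR n + 1 + 1)) * x) with (y + 2 * x)
    by (unfold y; ring).
  rewrite cos_minus, cos_plus. ring.
- now apply gauss_coef_step2_0.
- rewrite gauss_coef_step2_1 by exact hc. ring.
- intros k. rewrite gauss_coef_step2 by exact hc. ring.
- unfold gauss_coef. rewrite qbinom_gt by lia. ring.
- unfold gauss_coef. rewrite qbinom_gt by lia. ring.
Qed.

(** The number of indices that fold onto [j]: the centre exists only for an odd
    number of terms, [p = 0], and there it is counted once. *)
Definition fold_weight (p j : nat) : R := if (p + j =? 0)%nat then 1 else 2.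

(** Induction on [N] peels off the two extreme terms of the sum, which are equal
    by symmetry. *)
Lemma sum_fold p N (f : nat -> R) : (p <= 1)%nat ->
  (forall k, (k <= 2 * N + p)%nat -> f (2 * N + p - k)%nat = f k) ->
  sum_f_R0 f (2 * N + p) =
    sum_f_R0 (fun j => fold_weight p j * f (N + p + j)%nat) N.
Proof.
intros hp; revert f; induction N as [|N IH]; intros f hf.
- destruct p as [|[|p]]; [| |lia]; simpl; unfold fold_weight; simpl; [ring|].
  rewrite <- (hf 0%nat) by lia. simpl; ring.
- replace (2 * S N + p)%nat with (S (S (2 * N + p))) in * by lia.
  rewrite decomp_sum by lia.
  rewrite Nat.pred_succ, tech5.
  rewrite (IH (fun k => f (S k))).
  + rewrite tech5.
    replace (fold_weight p (S N)) with 2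
      by (unfold fold_weight; now rewrite Nat.add_succ_r).
    replace (S N + p + S N)%nat with (S (S (2 * N + p))) by lia.
    rewrite <- (hf 0%nat) by lia. rewrite Nat.sub_0_r.
    change (fun j => fold_weight p j * f (S N + p + j)%nat)
      with (fun j => fold_weight p j * f (S (N + p + j))).
    ring.
  + intros k hk. rewrite <- (hf (S k)) by lia. f_equal; lia.
Qed.

(** The coefficients of theta_3 ([p = 0]) and theta_2 ([p = 1]) as cosine series
    with frequencies [2 j + p]. *)
Definition theta_coef (c : R) (p j : nat) : R :=
  fold_weight p j * exp (- (c * (INR j + INR p / 2) ^ 2)).

Lemma gauss_sum_fold c p N x : (p <= 1)%nat ->
  gauss_sum c (2 * N + p) x =
    sum_f_R0 (fun j => qbinom (exp (- (2 * c))) (2 * N + p) (N + p + j)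
                       * (theta_coef c p j * cos (INR (2 * j + p) * x))) N.
Proof.
intros hp. unfold gauss_sum. rewrite sum_fold; [|exact hp|].
- apply sum_eq; intros j _. unfold gauss_coef, theta_coef.
  rewrite !plus_INR, !mult_INR. change (INR 2) with 2.
  replace ((INR N + INR p + INR j - (2 * INR N + INR p) / 2) ^ 2)
    with ((INR j + INR p / 2) ^ 2) by field.
  replace (2 * (INR N + INR p + INR j) - (2 * INR N + INR p))
    with (2 * INR j + INR p) by ring.
  ring.
- intros k hk. unfold gauss_coef. rewrite qbinom_sym by exact hk.
  rewrite minus_INR by exact hk.
  replace ((INR (2 * N + p) - INR k - INR (2 * N + p) / 2) ^ 2)
    with ((INR k - INR (2 * N + p) / 2) ^ 2) by field.
  rewrite <- (cos_neg ((2 * INR k - INR (2 * N + p)) * x)).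
  f_equal. f_equal. ring.
Qed.

(** * Dominated convergence and termwise differentiation *)

Lemma partial_sums_lim (b : nat -> R) : ex_series b ->
  is_lim_seq (sum_f_R0 b) (Series b).
Proof.
intros hb. apply is_lim_seq_ext with (sum_n b); [intros; apply sum_n_Reals|].
exact (Series_correct b hb).
Qed.

Lemma sum_lim_0 (d : nat -> nat -> R) (M : nat -> R) J :
  (forall j, is_lim_seq (fun N => d N j) 0) ->
  is_lim_seq (fun N => sum_f_R0 (fun j => Rabs (d N j) * M j) J) 0.
Proof.
intros hd.
assert (h : forall j, is_lim_seq (fun N => Rabs (d N j) * M j) 0).
{ intros j. rewrite <- (Rmult_0_l (M j)).
  apply is_lim_seq_mult'; [|apply is_lim_seq_const].
  rewrite <- Rabs_R0. now apply (is_lim_seq_abs _ (Finite 0)). }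
induction J as [|J IH]; [apply h|].
apply is_lim_seq_ext with
  (fun N => sum_f_R0 (fun j => Rabs (d N j) * M j) J + Rabs (d N (S J)) * M (S J));
  [reflexivity|].
rewrite <- (Rplus_0_l 0). now apply is_lim_seq_plus'.
Qed.

(** The head up to [J] is kept, the tail is estimated by the uniform bound [K]
    on [d] and the remainder of the series of [Rabs (b j)].  The bound must not
    depend on [N], so both cases [N <= J] and [J < N] are covered. *)
Lemma sum_split_bound (d b : nat -> R) K T J N :
  (forall j, Rabs (d j) <= K) ->
  (forall n, sum_f_R0 (fun j => Rabs (b j)) n <= T) ->
  Rabs (sum_f_R0 (fun j => d j * b j) N) <=
    sum_f_R0 (fun j => Rabs (d j) * Rabs (b j)) J
    + K * (T - sum_f_R0 (fun j => Rabs (b j)) J).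
Proof.
intros hd hT.
apply Rle_trans with (sum_f_R0 (fun j => Rabs (d j) * Rabs (b j)) N).
{ apply Rle_trans with (1 := Rsum_abs _ _).
  right; apply sum_eq; intros; apply Rabs_mult. }
assert (hK : 0 <= K) by (apply Rle_trans with (2 := hd 0%nat), Rabs_pos).
destruct (Nat.le_gt_cases N J) as [h|h].
- apply Rle_trans with (sum_f_R0 (fun j => Rabs (d j) * Rabs (b j)) J).
  + induction h as [|J h IH]; [lra|]. simpl.
    generalize (Rmult_le_pos _ _ (Rabs_pos (d (S J))) (Rabs_pos (b (S J)))); lra.
  + specialize (hT J). nra.
- apply Rle_trans with (sum_f_R0 (fun j => Rabs (d j) * Rabs (b j)) J
    + K * (sum_f_R0 (fun j => Rabs (b j)) N - sum_f_R0 (fun j => Rabs (b j)) J)).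
  + apply Nat.lt_le_incl in h.
    induction h as [|N h IH]; [lra|]. simpl.
    generalize (Rmult_le_compat_r _ _ _ (Rabs_pos (b (S N))) (hd (S N))); lra.
  + specialize (hT N). nra.
Qed.

(** Tannery's theorem for a limit [l] common to all columns: after
    subtracting [l], the head of the sum tends to 0 termwise and the tail is
    uniformly small. *)
Lemma tannery (c : nat -> nat -> R) (b : nat -> R) (l K : R) :
  (forall N j, Rabs (c N j) <= K) ->
  (forall j, is_lim_seq (fun N => c N j) l) ->
  ex_series (fun j => Rabs (b j)) ->
  is_lim_seq (fun N => sum_f_R0 (fun j => c N j * b j) N) (l * Series b).
Proof.
intros hc hl hb.
set (K' := K + Rabs l). set (T := Series (fun j => Rabs (b j))).
assert (hd : forall N j, Rabs (c N j - l) <= K').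
{ intros N j. apply Rle_trans with (1 := Rabs_triang _ _).
  rewrite Rabs_Ropp. unfold K'. generalize (hc N j); lra. }
assert (hK' : 0 <= K') by (apply Rle_trans with (2 := hd 0%nat 0%nat), Rabs_pos).
assert (hlim := partial_sums_lim _ hb). fold T in hlim.
assert (hT : forall n, sum_f_R0 (fun j => Rabs (b j)) n <= T).
{ intros n. apply (is_lim_seq_incr_compare _ T hlim).
  intros m. simpl. generalize (Rabs_pos (b (S m))); lra. }
assert (h0 : is_lim_seq (fun N => sum_f_R0 (fun j => (c N j - l) * b j) N) 0).
{ apply is_lim_seq_spec. intros eps.
  assert (he : 0 < eps / (2 * (K' + 1)))
    by (apply Rdiv_lt_0_compat; [apply cond_pos | lra]).
  destruct (proj2 (is_lim_seq_spec _ (Finite T)) hlim (mkposreal _ he)) as [J hJ].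
  specialize (hJ J (Nat.le_refl J)). simpl in hJ.
  assert (hz : is_lim_seq
    (fun N => sum_f_R0 (fun j => Rabs (c N j - l) * Rabs (b j)) J) 0).
  { apply (sum_lim_0 (fun N j => c N j - l) (fun j => Rabs (b j))). intros j.
    rewrite <- (Rminus_diag l).
    apply is_lim_seq_minus'; [apply hl | apply is_lim_seq_const]. }
  destruct (proj2 (is_lim_seq_spec _ (Finite 0)) hz (pos_div_2 eps)) as [N0 hN0].
  exists N0; intros N hN. specialize (hN0 N hN). simpl in hN0.
  rewrite Rminus_0_r in hN0 |- *.
  apply Rle_lt_trans with (1 := sum_split_bound (fun j => c N j - l) b K' T J N
                                  (hd N) hT).
  apply Rle_lt_trans with (1 := Rle_abs _) in hN0.
  rewrite Rabs_minus_sym in hJ. apply Rle_lt_trans with (1 := Rle_abs _) in hJ.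
  assert (K' * (T - sum_f_R0 (fun j => Rabs (b j)) J) <= eps / 2); [|lra].
  replace (eps / 2) with ((K' + 1) * (eps / (2 * (K' + 1)))) by (field; lra).
  specialize (hT J). apply Rmult_le_compat; lra. }
apply is_lim_seq_ext with
  (fun N => sum_f_R0 (fun j => (c N j - l) * b j) N + l * sum_f_R0 b N).
- intros N. rewrite scal_sum, <- sum_plus. apply sum_eq; intros; ring.
- rewrite <- (Rplus_0_l (l * Series b)). apply is_lim_seq_plus'; [exact h0|].
  apply is_lim_seq_mult'; [apply is_lim_seq_const|].
  apply partial_sums_lim, ex_series_Rabs, hb.
Qed.

Lemma sin_lipschitz a b : Rabs (sin a - sin b) <= Rabs (a - b).
Proof.
destruct (MVT_gen sin b a cos) as [xi [_ h]].
- intros; auto_derive; [easy | ring].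
- intros; apply continuity_sin.
- rewrite h, Rabs_mult. rewrite <- (Rmult_1_l (Rabs (a - b))) at 2.
  apply Rmult_le_compat_r; [apply Rabs_pos|].
  apply Rabs_le, COS_bound.
Qed.

Lemma cos_taylor a b : Rabs (cos a - cos b + (a - b) * sin b) <= (a - b) ^ 2.
Proof.
destruct (MVT_gen cos b a (fun x => - sin x)) as [xi [hxi h]].
- intros; auto_derive; [easy | ring].
- intros; apply continuity_cos.
- rewrite h.
  replace (- sin xi * (a - b) + (a - b) * sin b)
    with (- (a - b) * (sin xi - sin b)) by ring.
  rewrite Rabs_mult, Rabs_Ropp, <- Rsqr_pow2, Rsqr_abs.
  apply Rmult_le_compat_l; [apply Rabs_pos|].
  apply Rle_trans with (1 := sin_lipschitz _ _).
  revert hxi; unfold Rmin, Rmax, Rabs.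
  destruct (Rle_dec b a), (Rcase_abs (xi - b)), (Rcase_abs (a - b)); lra.
Qed.

(** A quadratic remainder estimate survives summation of a series, which makes
    termwise differentiation possible without uniform convergence on
    intervals. *)
Lemma is_derive_quadratic (f : R -> R) x l M :
  (forall y, Rabs (f y - f x - (y - x) * l) <= M * (y - x) ^ 2) ->
  is_derive f x l.
Proof.
intros h. apply is_derive_Reals. intros eps heps.
assert (hM : 0 <= M).
{ generalize (Rle_trans _ _ _ (Rabs_pos _) (h (x + 1))).
  replace (x + 1 - x) with 1 by ring. lra. }
assert (hd : 0 < eps / (M + 1)) by (apply Rdiv_lt_0_compat; lra).
exists (mkposreal _ hd). intros y hy0 hy. simpl in hy.
replace ((f (x + y) - f x) / y - l) with ((f (x + y) - f x - y * l) / y)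
  by (field; exact hy0).
specialize (h (x + y)). replace (x + y - x) with y in h by ring.
assert (hy' : 0 < Rabs y) by now apply Rabs_pos_lt.
unfold Rdiv; rewrite Rabs_mult, Rabs_inv.
apply Rle_lt_trans with (M * y ^ 2 * / Rabs y).
- apply Rmult_le_compat_r; [left; now apply Rinv_0_lt_compat | exact h].
- replace (M * y ^ 2 * / Rabs y) with (M * Rabs y).
  + apply Rle_lt_trans with ((M + 1) * Rabs y); [nra|].
    apply Rmult_lt_compat_l with (r := M + 1) in hy; [|lra].
    replace ((M + 1) * (eps / (M + 1))) with eps in hy by (field; lra). exact hy.
  + rewrite <- Rsqr_pow2, Rsqr_abs. unfold Rsqr. field. lra.
Qed.

Lemma ex_series_dominated (a b : nat -> R) :
  (forall n, Rabs (a n) <= b n) -> ex_series b -> ex_series a.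
Proof. intros h; now apply (@ex_series_le R_AbsRing R_CompleteNormedModule). Qed.

Lemma is_derive_cos_series (b la : nat -> R) x :
  ex_series (fun j => Rabs (b j) * (1 + la j ^ 2)) ->
  is_derive (fun y => Series (fun j => b j * cos (la j * y))) x
    (Series (fun j => b j * (- la j * sin (la j * x)))).
Proof.
intros hb.
assert (hcos : forall y, ex_series (fun j => b j * cos (la j * y))).
{ intros y. apply ex_series_dominated with (2 := hb). intros j.
  rewrite Rabs_mult. apply Rmult_le_compat_l; [apply Rabs_pos|].
  apply Rle_trans with 1; [apply Rabs_le, COS_bound | generalize (pow2_ge_0 (la j)); lra]. }
assert (hsin : ex_series (fun j => b j * (- la j * sin (la j * x)))).
{ apply ex_series_dominated with (2 := hb). intros j.
  rewrite Rabs_mult. apply Rmult_le_compat_l; [apply Rabs_pos|].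
  rewrite Rabs_mult, Rabs_Ropp.
  apply Rle_trans with (Rabs (la j) * 1).
  - apply Rmult_le_compat_l; [apply Rabs_pos | apply Rabs_le, SIN_bound].
  - rewrite <- (pow2_abs (la j)).
    generalize (Rabs_pos (la j)); nra. }
apply is_derive_quadratic with (Series (fun j => Rabs (b j) * (1 + la j ^ 2))).
intros y.
rewrite <- Series_minus, <- Series_scal_l by auto.
rewrite <- Series_minus.
2: { now apply (ex_series_minus (V := R_NormedModule)). }
2: { now apply (ex_series_scal (V := R_NormedModule)). }
rewrite <- Series_scal_r.
set (e := fun n => _).
assert (he : forall j, Rabs (e j) <= Rabs (b j) * (1 + la j ^ 2) * (y - x) ^ 2).
{ intros j. unfold e.
  replace (b j * cos (la j * y) - b j * cos (la j * x)
           - (y - x) * (b j * (- la j * sin (la j * x))))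
    with (b j * (cos (la j * y) - cos (la j * x)
                 + (la j * y - la j * x) * sin (la j * x))) by ring.
  rewrite Rabs_mult, Rmult_assoc. apply Rmult_le_compat_l; [apply Rabs_pos|].
  apply Rle_trans with (1 := cos_taylor _ _).
  generalize (pow2_ge_0 (y - x)); nra. }
assert (hs : ex_series (fun j => Rabs (b j) * (1 + la j ^ 2) * (y - x) ^ 2))
  by now apply ex_series_scal_r.
assert (hse : ex_series (fun j => Rabs (e j))).
{ apply ex_series_dominated with (2 := hs). intros j; rewrite Rabs_Rabsolu; apply he. }
apply Rle_trans with (1 := Series_Rabs e hse).
apply Series_le; [|exact hs].
intros j; split; [apply Rabs_pos | apply he].
Qed.

(** Half of the exponential decay beats the polynomial factor. *)
Lemma exp_decay_sq_summable c : 0 < c ->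
  ex_series (fun j => exp (- (c * INR j)) * (INR j + 1) ^ 2).
Proof.
intros hc.
(* K is chosen so that j + 1 <= K (1 + c j / 4) <= K exp (c j / 4). *)
set (K := 1 + 4 / c).
apply ex_series_dominated with (fun j => K ^ 2 * exp (- (c / 2)) ^ j).
- intros j.
  assert (hj : 0 <= INR j) by apply pos_INR.
  rewrite Rabs_pos_eq by (apply Rmult_le_pos; [left; apply exp_pos | apply pow2_ge_0]).
  rewrite exp_pow.
  assert (h : INR j + 1 <= K * exp (c / 4 * INR j)).
  { apply Rle_trans with (K * (1 + c / 4 * INR j)).
    - assert (0 < 4 / c) by (apply Rdiv_lt_0_compat; lra).
      assert (4 / c * (c / 4) = 1) by (field; lra). unfold K.
      assert (0 <= c / 4 * INR j) by (apply Rmult_le_pos; lra).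
      nra.
    - apply Rmult_le_compat_l; [|apply exp_ineq1_le].
      unfold K. assert (0 < 4 / c) by (apply Rdiv_lt_0_compat; lra). lra. }
  apply Rle_trans with (exp (- (c * INR j)) * (K * exp (c / 4 * INR j)) ^ 2).
  + apply Rmult_le_compat_l; [left; apply exp_pos|]. apply pow_incr; lra.
  + right. rewrite Rpow_mult_distr, exp_pow.
    rewrite (Rmult_comm (K ^ 2)), <- Rmult_assoc, <- exp_plus, Rmult_comm.
    f_equal. f_equal. simpl. field.
- apply (ex_series_scal (V := R_NormedModule)), ex_series_geom.
  generalize (exp_neg_in_unit (c / 2)); intros h. rewrite Rabs_pos_eq; lra.
Qed.

(** * The theta functions as limits of Gauss sums *)

Lemma theta_coef_bound c p j : 0 < c ->
  0 <= theta_coef c p j <= 2 * exp (- (c * INR j)).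
Proof.
intros hc.
assert (hw : 0 <= fold_weight p j <= 2)
  by (unfold fold_weight; destruct (p + j =? 0)%nat; lra).
assert (he : exp (- (c * (INR j + INR p / 2) ^ 2)) <= exp (- (c * INR j))).
{ apply exp_le_exp, Ropp_le_contravar, Rmult_le_compat_l; [lra|].
  generalize (pos_INR p); intros hp.
  destruct j as [|j]; [simpl; nra|].
  rewrite S_INR. generalize (pos_INR j); nra. }
generalize (exp_pos (- (c * (INR j + INR p / 2) ^ 2))).
unfold theta_coef; nra.
Qed.

Lemma theta_coef_summable c p : 0 < c -> (p <= 1)%nat ->
  ex_series (fun j => Rabs (theta_coef c p j) * (1 + INR (2 * j + p) ^ 2)).
Proof.
intros hc hp.
apply ex_series_dominated with
  (fun j => 10 * (exp (- (c * INR j)) * (INR j + 1) ^ 2)).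
- intros j. generalize (theta_coef_bound c p j hc); intros h.
  assert (hj : 0 <= INR j) by apply pos_INR.
  assert (hp' : 0 <= INR p <= 1)
    by (split; [apply pos_INR | apply (le_INR p 1 hp)]).
  rewrite (Rabs_pos_eq (theta_coef c p j)) by lra.
  rewrite plus_INR, mult_INR. change (INR 2) with 2.
  generalize (pow2_ge_0 (2 * INR j + INR p)); intros h2.
  rewrite Rabs_pos_eq by (apply Rmult_le_pos; lra).
  apply Rle_trans with (2 * exp (- (c * INR j)) * (1 + (2 * INR j + INR p) ^ 2)).
  + apply Rmult_le_compat_r; lra.
  + generalize (exp_pos (- (c * INR j))); intros he.
    assert (1 + (2 * INR j + INR p) ^ 2 <= 5 * (INR j + 1) ^ 2) by nra.
    nra.
- apply (ex_series_scal (V := R_NormedModule)), exp_decay_sq_summable, hc.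
Qed.

Lemma theta_coef_mul_summable c p (f : nat -> R) : 0 < c -> (p <= 1)%nat ->
  (forall j, Rabs (f j) <= 1 + INR (2 * j + p) ^ 2) ->
  ex_series (fun j => Rabs (theta_coef c p j * f j)).
Proof.
intros hc hp hf.
apply ex_series_dominated with (2 := theta_coef_summable c p hc hp). intros j.
rewrite Rabs_Rabsolu, Rabs_mult. apply Rmult_le_compat_l; [apply Rabs_pos | apply hf].
Qed.

Lemma theta_series_summable c p x : 0 < c -> (p <= 1)%nat ->
  ex_series (fun j => Rabs (theta_coef c p j * cos (INR (2 * j + p) * x))).
Proof.
intros hc hp; apply theta_coef_mul_summable; [exact hc | exact hp|]. intros j.
apply Rle_trans with 1; [apply Rabs_le, COS_bound|].
generalize (pow2_ge_0 (INR (2 * j + p))); lra.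
Qed.

Definition theta_series (c : R) (p : nat) (x : R) : R :=
  Series (fun j => theta_coef c p j * cos (INR (2 * j + p) * x)).

Definition theta_series_deriv (c : R) (p : nat) (x : R) : R :=
  Series (fun j => theta_coef c p j * (- INR (2 * j + p) * sin (INR (2 * j + p) * x))).

Lemma is_derive_theta_series c p x : 0 < c -> (p <= 1)%nat ->
  is_derive (theta_series c p) x (theta_series_deriv c p x).
Proof.
intros hc hp.
apply (is_derive_cos_series (theta_coef c p) (fun j => INR (2 * j + p))).
now apply theta_coef_summable.
Qed.

Lemma gauss_sum_start c p x : 0 < c -> (p <= 1)%nat ->
  gauss_sum c p x = theta_coef c p 0 * cos (INR p * x).
Proof.
intros hc hp. generalize (gauss_sum_fold c p 0 x hp). simpl.
rewrite Nat.add_0_r, qbinom_diag by (apply exp_neg_in_unit; lra).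
intros ->. ring.
Qed.

Lemma gauss_nome_in_unit c n : 0 < c -> 0 < gauss_nome c n < 1.
Proof.
intros hc; apply exp_neg_in_unit, Rmult_lt_0_compat; [lra|].
generalize (pos_INR n); lra.
Qed.

Definition log_term (y x : R) : R := sin (2 * x) / (cosh y + cos (2 * x)).

(** This is how the hyperbolic cosine of the formulas arises: with s = exp(-y),
    1 + s^2 = 2 s cosh y. *)
Lemma gauss_factor_cosh y x :
  1 + 2 * exp (- y) * cos (2 * x) + exp (- y) ^ 2
  = 2 * exp (- y) * (cosh y + cos (2 * x)).
Proof.
unfold cosh. rewrite exp_Ropp. field. apply Rgt_not_eq, exp_pos.
Qed.

Lemma gauss_factor_lower s x : 0 < s < 1 ->
  (1 - s) ^ 2 <= 1 + 2 * s * cos (2 * x) + s ^ 2.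
Proof. intros hs. generalize (COS_bound (2 * x)); nra. Qed.

(** Each new factor of the product adds its own logarithmic derivative
    -4 s sin 2x / (1 + 2 s cos 2x + s^2) = -2 sin 2x / (cosh y + cos 2x). *)
Lemma is_derive_gauss_step c n x D : 0 < c ->
  is_derive (gauss_sum c n) x (gauss_sum c n x * D) ->
  is_derive (gauss_sum c (S (S n))) x
    (gauss_sum c (S (S n)) x * (D + -2 * log_term (c * (INR n + 1)) x)).
Proof.
intros hc hD.
set (s := gauss_nome c n).
apply is_derive_ext with
  (fun y => gauss_sum c n y * (1 + 2 * s * cos (2 * y) + s ^ 2)).
{ intros y; symmetry; now apply gauss_sum_step2. }
rewrite gauss_sum_step2 by exact hc. fold s.
assert (hP : is_derive (fun y => 1 + 2 * s * cos (2 * y) + s ^ 2) x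
               (- (4 * s * sin (2 * x)))).
{ auto_derive; [easy | ring]. }
assert (h := is_derive_mult _ _ x _ _ hD hP Rmult_comm).
eapply eq_ind; [exact h|].
unfold plus, mult; simpl.
assert (hs : 0 < s < 1) by now apply gauss_nome_in_unit.
assert (hp := gauss_factor_lower s x hs).
assert (hf := gauss_factor_cosh (c * (INR n + 1)) x).
change (exp (- (c * (INR n + 1)))) with s in hf.
simpl in hf, hp. rewrite hf. unfold log_term. field.
intros h0. rewrite h0, Rmult_0_r in hf. nra.
Qed.

Lemma is_derive_gauss_sum c p N x : 0 < c -> (p <= 1)%nat -> cos (INR p * x) <> 0 ->
  is_derive (gauss_sum c (2 * S N + p)) x
    (gauss_sum c (2 * S N + p) x *
      (- (INR p * tan (INR p * x))
       + -2 * sum_f_R0 (fun k => log_term (c * (INR (2 * k + p) + 1)) x) N)).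
Proof.
intros hc hp hcos.
induction N as [|N IH].
- apply is_derive_gauss_step; [exact hc|].
  apply is_derive_ext with (fun y => theta_coef c p 0 * cos (INR p * y)).
  { intros y; symmetry; now apply gauss_sum_start. }
  simpl (2 * 0 + p)%nat. rewrite gauss_sum_start by assumption.
  auto_derive; [easy|]. unfold tan. field. exact hcos.
- replace (2 * S (S N) + p)%nat with (S (S (2 * S N + p))) by lia.
  rewrite tech5, (Rmult_plus_distr_l (-2)), <- Rplus_assoc.
  now apply is_derive_gauss_step.
Qed.

(** The same derivative read off the expanded form, suited to [tannery]. *)
Lemma is_derive_gauss_fold c p N x : (p <= 1)%nat ->
  is_derive (gauss_sum c (2 * N + p)) x
    (sum_f_R0 (fun j => qbinom (exp (- (2 * c))) (2 * N + p) (N + p + j) *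
      (theta_coef c p j * (- INR (2 * j + p) * sin (INR (2 * j + p) * x)))) N).
Proof.
intros hp.
apply is_derive_ext with (1 := fun y => eq_sym (gauss_sum_fold c p N y hp)).
generalize (qbinom (exp (- (2 * c))) (2 * N + p)); intros a.
rewrite <- sum_n_Reals.
apply is_derive_ext with (fun y => sum_n (fun j => a (N + p + j)%nat *
   (theta_coef c p j * cos (INR (2 * j + p) * y))) N).
{ intros y; apply sum_n_Reals. }
apply (is_derive_sum_n (K := R_AbsRing) (V := R_NormedModule)
  (fun j y => a (N + p + j)%nat * (theta_coef c p j * cos (INR (2 * j + p) * y)))).
intros j _. generalize (INR (2 * j + p)); intros la. auto_derive; [easy | ring].
Qed.

(** Each factor of the product form is at least (1 - q^(2k+p+1))^2, hence at
    least (1 - q^(k+1))^2; this is what keeps the limit away from 0. *)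
Lemma gauss_sum_lower c p N x : 0 < c -> (p <= 1)%nat ->
  Rabs (theta_coef c p 0 * cos (INR p * x)) * qfact (exp (- c)) N ^ 2
  <= Rabs (gauss_sum c (2 * N + p) x).
Proof.
intros hc hp.
assert (hq := exp_neg_in_unit c hc).
induction N as [|N IH].
- simpl (2 * 0 + p)%nat. rewrite gauss_sum_start by assumption. simpl; lra.
- replace (2 * S N + p)%nat with (S (S (2 * N + p))) by lia.
  assert (hK := Rabs_pos (theta_coef c p 0 * cos (INR p * x))).
  set (K := Rabs (theta_coef c p 0 * cos (INR p * x))) in *.
  rewrite gauss_sum_step2, Rabs_mult by exact hc.
  change (qfact (exp (- c)) (S N))
    with (qfact (exp (- c)) N * (1 - exp (- c) ^ S N)).
  rewrite Rpow_mult_distr, <- Rmult_assoc.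
  apply Rmult_le_compat; [| apply pow2_ge_0 | exact IH |].
  { apply Rmult_le_pos; [exact hK | apply pow2_ge_0]. }
  assert (hs := gauss_nome_in_unit c (2 * N + p) hc).
  assert (hl := gauss_factor_lower _ x hs).
  apply Rle_trans with (2 := Rle_abs _), Rle_trans with (2 := hl).
  apply pow_incr.
  assert (h1 := pow_S_in_unit _ N hq).
  assert (hle : gauss_nome c (2 * N + p) <= exp (- c) ^ S N); [|lra].
  rewrite exp_pow, S_INR. unfold gauss_nome.
  apply exp_le_exp. rewrite plus_INR, mult_INR. change (INR 2) with 2.
  generalize (pos_INR N) (pos_INR p); nra.
Qed.

Lemma theta_coef_0_pos c p : 0 < theta_coef c p 0.
Proof.
apply Rmult_lt_0_compat; [|apply exp_pos].
unfold fold_weight; destruct (p + 0 =? 0)%nat; lra.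
Qed.

(** Both sides of the product recursion are differentiated and the limit is
    taken in the quotient: the common factor 1/L cancels, and the partial sums
    of the series converge because the quotient does. *)
Lemma log_derivative_theta_series c p x : 0 < c -> (p <= 1)%nat ->
  cos (INR p * x) <> 0 ->
  theta_series c p x <> 0 /\
  is_series (fun k => log_term (c * (INR (2 * k + p) + 1)) x)
    (- (theta_series_deriv c p x / theta_series c p x
        + INR p * tan (INR p * x)) / 2).
Proof.
intros hc hp hcos.
set (r := exp (- (2 * c))).
assert (hr : 0 < r < 1) by (apply exp_neg_in_unit; lra).
destruct (qfact_lim r hr) as [L [hL hlim]].
assert (hbound : forall N j, Rabs (qbinom r (2 * N + p) (N + p + j))
                   <= / (qfact_floor r * qfact_floor r)).
{ intros N j. rewrite Rabs_pos_eq; apply qbinom_bounds, hr. }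
assert (hG : is_lim_seq (fun N => gauss_sum c (2 * N + p) x)
               (/ L * theta_series c p x)).
{ apply is_lim_seq_ext with (1 := fun N => eq_sym (gauss_sum_fold c p N x hp)).
  apply (tannery (fun N j => qbinom r (2 * N + p) (N + p + j))) with (1 := hbound).
  - intros j; now apply qbinom_central_lim.
  - now apply theta_series_summable. }
assert (hG' : is_lim_seq (fun N => Derive (gauss_sum c (2 * N + p)) x)
               (/ L * theta_series_deriv c p x)).
{ apply is_lim_seq_ext with
    (1 := fun N => eq_sym (is_derive_unique _ _ _ (is_derive_gauss_fold c p N x hp))).
  apply (tannery (fun N j => qbinom r (2 * N + p) (N + p + j))) with (1 := hbound).
  - intros j; now apply qbinom_central_lim.
  - apply theta_coef_mul_summable; [exact hc | exact hp|]. intros j.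
    rewrite Rabs_mult, Rabs_Ropp.
    generalize (pos_INR (2 * j + p)); intros hj.
    rewrite (Rabs_pos_eq (INR _)) by exact hj.
    apply Rle_trans with (INR (2 * j + p) * 1); [|nra].
    apply Rmult_le_compat_l; [exact hj | apply Rabs_le, SIN_bound]. }
set (q := exp (- c)).
set (delta := Rabs (theta_coef c p 0 * cos (INR p * x)) * qfact_floor q ^ 2).
assert (hdelta : 0 < delta).
{ apply Rmult_lt_0_compat; [|apply pow_lt, qfact_floor_pos].
  apply Rabs_pos_lt, Rmult_integral_contrapositive_currified; [|exact hcos].
  apply Rgt_not_eq, theta_coef_0_pos. }
assert (hGlow : forall N, delta <= Rabs (gauss_sum c (2 * N + p) x)).
{ intros N. apply Rle_trans with (2 := gauss_sum_lower c p N x hc hp).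
  apply Rmult_le_compat_l; [apply Rabs_pos|]. apply pow_incr.
  split; [left; apply qfact_floor_pos|]. now apply qfact_lower, exp_neg_in_unit. }
assert (hne : / L * theta_series c p x <> 0).
{ assert (h : delta <= Rabs (/ L * theta_series c p x)).
  { apply (is_lim_seq_le (fun _ => delta) _ (Finite delta)
             (Finite (Rabs (/ L * theta_series c p x))) hGlow);
      [apply is_lim_seq_const | now apply (is_lim_seq_abs _ (Finite _))]. }
  intros h0; rewrite h0, Rabs_R0 in h; lra. }
assert (hth : theta_series c p x <> 0) by (intros h; apply hne; rewrite h; ring).
split; [exact hth|].
assert (hquot := is_lim_seq_div' _ _ _ _ hG' hG hne).
(* The N-th partial sum has N + 1 terms and belongs to G_(2(N+1)+p). *)
apply is_lim_seq_incr_1 in hquot.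
change (is_lim_seq (sum_n (fun k => log_term (c * (INR (2 * k + p) + 1)) x))
  (- (theta_series_deriv c p x / theta_series c p x + INR p * tan (INR p * x)) / 2)).
apply is_lim_seq_ext with (fun N =>
  (Derive (gauss_sum c (2 * S N + p)) x / gauss_sum c (2 * S N + p) x
   + INR p * tan (INR p * x)) * (- / 2)).
- intros N. rewrite sum_n_Reals.
  rewrite (is_derive_unique _ _ _ (is_derive_gauss_sum c p N x hc hp hcos)).
  assert (h0 : gauss_sum c (2 * S N + p) x <> 0).
  { intros h; generalize (hGlow (S N)); rewrite h, Rabs_R0; lra. }
  field. exact h0.
- replace (- (theta_series_deriv c p x / theta_series c p x
              + INR p * tan (INR p * x)) / 2)
    with ((/ L * theta_series_deriv c p x / (/ L * theta_series c p x)
           + INR p * tan (INR p * x)) * (- / 2)) by (field; split; [exact hth | lra]).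
  apply is_lim_seq_mult'; [|apply is_lim_seq_const].
  apply is_lim_seq_plus'; [exact hquot | apply is_lim_seq_const].
Qed.

(** The four theta functions are all of the form theta_series(pi u + a), with
    [a] a multiple of pi/2; the chain rule contributes the factor pi. *)
Lemma log_derivative_of_shift (f : R -> R) c p a u : 0 < c -> (p <= 1)%nat ->
  (forall v, f v = theta_series c p (PI * v + a)) ->
  cos (INR p * (PI * u + a)) <> 0 ->
  ex_derive f u /\ f u <> 0 /\
  is_series (fun k => log_term (c * (INR (2 * k + p) + 1)) (PI * u + a))
    (- (Derive f u / f u + PI * (INR p * tan (INR p * (PI * u + a)))) / (2 * PI)).
Proof.
intros hc hp hf hcos.
destruct (log_derivative_theta_series c p (PI * u + a) hc hp hcos) as [hne hs].
assert (hd : is_derive f u (PI * theta_series_deriv c p (PI * u + a))).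
{ apply is_derive_ext with (fun v => theta_series c p (PI * v + a)).
  { intros v; symmetry; apply hf. }
  apply (is_derive_comp (theta_series c p) (fun v => PI * v + a)).
  - now apply is_derive_theta_series.
  - auto_derive; [easy | ring]. }
split; [now exists (PI * theta_series_deriv c p (PI * u + a))|].
split; [now rewrite hf|].
rewrite (is_derive_unique _ _ _ hd), hf.
replace (- _ / (2 * PI)) with (- (theta_series_deriv c p (PI * u + a)
   / theta_series c p (PI * u + a)
        + INR p * tan (INR p * (PI * u + a))) / 2).
{ exact hs. }
field. split; [exact hne | apply PI_neq0].
Qed.

(** * The four theta functions *)

Lemma Rpower_nome t y : Rpower (nome t) y = exp (- (PI ^ 2 * t * y)).
Proof. unfold Rpower, nome. rewrite ln_exp. f_equal; ring. Qed.

Lemma nome_pow t n : nome t ^ n = exp (- (PI ^ 2 * t * INR n)).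
Proof. unfold nome. rewrite exp_pow. f_equal; ring. Qed.

Lemma nome_rate_pos t : 0 < t -> 0 < PI ^ 2 * t.
Proof.
intros ht. apply Rmult_lt_0_compat; [apply pow_lt, PI_RGT_0 | exact ht].
Qed.

Lemma theta_series_0_unfold c x : 0 < c ->
  theta_series c 0 x =
    1 + 2 * Series (fun n => exp (- (c * INR (S n) ^ 2)) * cos (2 * INR (S n) * x)).
Proof.
intros hc. unfold theta_series. rewrite Series_incr_1.
- rewrite <- Series_scal_l. f_equal.
  + unfold theta_coef, fold_weight. simpl.
    replace (- _) with 0 by field. rewrite exp_0, Rmult_0_l, cos_0. ring.
  + apply Series_ext; intros n. unfold theta_coef, fold_weight.
    rewrite plus_INR, mult_INR. change (INR 2) with 2. change (INR 0) with 0.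
    replace (INR (S n) + 0 / 2) with (INR (S n)) by field.
    rewrite Rplus_0_r. simpl (0 + S n =? 0)%nat. cbn iota. ring.
- now apply ex_series_Rabs, theta_series_summable; [|lia].
Qed.

Lemma theta_series_1_unfold c x :
  theta_series c 1 x =
    2 * Series (fun n => exp (- (c * (INR n + 1 / 2) ^ 2)) * cos ((2 * INR n + 1) * x)).
Proof.
unfold theta_series. rewrite <- Series_scal_l. apply Series_ext; intros n.
unfold theta_coef, fold_weight. simpl (1 + n =? 0)%nat. cbn iota.
rewrite plus_INR, mult_INR. change (INR 2) with 2. change (INR 1) with 1. ring.
Qed.

Lemma cos_add_nat_PI n x : cos (x + INR n * PI) = (-1) ^ n * cos x.
Proof.
induction n as [|n IH]; [simpl; rewrite Rmult_0_l, Rplus_0_r; ring|].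
rewrite S_INR. replace (x + (INR n + 1) * PI) with (x + INR n * PI + PI) by ring.
rewrite neg_cos, IH. simpl; ring.
Qed.

Lemma theta3_eq u t : 0 < t -> theta3 u t = theta_series (PI ^ 2 * t) 0 (PI * u + 0).
Proof.
intros ht. rewrite theta_series_0_unfold by now apply nome_rate_pos.
unfold theta3. f_equal. f_equal. apply Series_ext; intros n.
rewrite nome_pow, mult_INR. f_equal; f_equal; ring.
Qed.

Lemma theta4_eq u t : 0 < t ->
  theta4 u t = theta_series (PI ^ 2 * t) 0 (PI * u + PI / 2).
Proof.
intros ht. rewrite theta_series_0_unfold by now apply nome_rate_pos.
unfold theta4. f_equal. f_equal. apply Series_ext; intros n.
rewrite nome_pow, mult_INR.
replace (2 * INR (S n) * (PI * u + PI / 2))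
  with (2 * INR (S n) * PI * u + INR (S n) * PI) by field.
rewrite cos_add_nat_PI.
replace (PI ^ 2 * t * (INR (S n) * INR (S n))) with (PI ^ 2 * t * INR (S n) ^ 2) by ring.
ring.
Qed.

Lemma theta2_eq u t : theta2 u t = theta_series (PI ^ 2 * t) 1 (PI * u + 0).
Proof.
rewrite theta_series_1_unfold. unfold theta2. f_equal.
apply Series_ext; intros n. rewrite Rpower_nome. f_equal; f_equal; ring.
Qed.

Lemma theta1_eq u t : theta1 u t = theta_series (PI ^ 2 * t) 1 (PI * u + - (PI / 2)).
Proof.
rewrite theta_series_1_unfold. unfold theta1. f_equal.
apply Series_ext; intros n. rewrite Rpower_nome.
replace (sin ((2 * INR n + 1) * PI * u))
  with (cos ((2 * INR n + 1) * (PI * u + - (PI / 2)) + INR n * PI)).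
- assert (hsq : (-1) ^ n * (-1) ^ n = 1).
  { rewrite <- Rpow_mult_distr. replace (-1 * -1) with 1 by ring. apply pow1. }
  rewrite cos_add_nat_PI. set (C := cos _). set (E := exp _).
  transitivity ((-1) ^ n * (-1) ^ n * (E * C)); [ring | rewrite hsq; ring].
- rewrite cos_sin. f_equal. field.
Qed.

Lemma log_term_shift y a u : cos (2 * a) = 1 -> sin (2 * a) = 0 ->
  log_term y (PI * u + a) = sin (2 * PI * u) / (cosh y + cos (2 * PI * u)).
Proof.
intros hc hs. unfold log_term.
replace (2 * (PI * u + a)) with (2 * PI * u + 2 * a) by ring.
rewrite sin_plus, cos_plus, hc, hs.
f_equal; [|f_equal; f_equal]; ring.
Qed.

Lemma log_term_half_shift y a u : cos (2 * a) = -1 -> sin (2 * a) = 0 ->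
  log_term y (PI * u + a) = - (sin (2 * PI * u) / (cosh y - cos (2 * PI * u))).
Proof.
intros hc hs. unfold log_term.
replace (2 * (PI * u + a)) with (2 * PI * u + 2 * a) by ring.
rewrite sin_plus, cos_plus, hc, hs. unfold Rdiv.
rewrite Ropp_mult_distr_l.
f_equal; [|f_equal]; ring.
Qed.

(** Solves the value of the series in [log_derivative_of_shift] for the
    logarithmic derivative; [k] accounts for the sign changes and the factors pi
    that distinguish the terms of the four formulas from [log_term]. *)
Lemma log_derivative_rescale f u (a b : nat -> R) (A k e v : R) :
  k <> 0 ->
  ex_derive f u /\ f u <> 0 /\ is_series a (- (Derive f u / f u + v) / (2 * PI)) ->
  (forall n, b n = k * a n) ->
  e * k = - (2 * PI) -> A = - v ->
  ex_derive f u /\ f u <> 0 /\ ex_series b /\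
  Derive f u / f u = A + e * Series b.
Proof.
intros hk [h1 [h2 h3]] hb he hA.
assert (hs : is_series b (k * (- (Derive f u / f u + v) / (2 * PI)))).
{ apply is_series_ext with (fun n => k * a n); [intros; symmetry; apply hb|].
  now apply (is_series_scal (V := R_NormedModule)). }
split; [exact h1|]. split; [exact h2|]. split; [now eexists; exact hs|].
rewrite (is_series_unique _ _ hs), <- Rmult_assoc, he, hA.
field. split; [exact h2 | apply PI_neq0].
Qed.

(* [Derive], [/] and [Series] are total, so each formula comes with the
   differentiability, nonvanishing and convergence that give it meaning. *)
Theorem theorem2 :
  forall t u : R, 0 < t -> 0 < u < 1 ->
  (ex_derive (fun v => theta4 v t) u /\ theta4 u t <> 0 /\
   ex_series (fun k : nat =>
     PI * sin (2 * PI * u)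
       / (cosh (2 * INR k * PI ^ 2 * t + PI ^ 2 * t) - cos (2 * PI * u))) /\
   Derive (fun v => theta4 v t) u / theta4 u t =
     2 * Series (fun k : nat =>
       PI * sin (2 * PI * u)
         / (cosh (2 * INR k * PI ^ 2 * t + PI ^ 2 * t) - cos (2 * PI * u))))
  /\
  (ex_derive (fun v => theta3 v t) u /\ theta3 u t <> 0 /\
   ex_series (fun k : nat =>
     PI * sin (2 * PI * u)
       / (cosh (2 * INR k * PI ^ 2 * t + PI ^ 2 * t) + cos (2 * PI * u))) /\
   Derive (fun v => theta3 v t) u / theta3 u t =
     - 2 * Series (fun k : nat =>
       PI * sin (2 * PI * u)
         / (cosh (2 * INR k * PI ^ 2 * t + PI ^ 2 * t) + cos (2 * PI * u))))
  /\
  (ex_derive (fun v => theta1 v t) u /\ theta1 u t <> 0 /\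
   ex_series (fun k : nat =>
     sin (2 * PI * u)
       / (cosh (2 * INR (S k) * PI ^ 2 * t) - cos (2 * PI * u))) /\
   Derive (fun v => theta1 v t) u / theta1 u t =
     PI * cot (PI * u)
     + 2 * PI * Series (fun k : nat =>
       sin (2 * PI * u)
         / (cosh (2 * INR (S k) * PI ^ 2 * t) - cos (2 * PI * u))))
  /\
  (u <> 1 / 2 ->
   ex_derive (fun v => theta2 v t) u /\ theta2 u t <> 0 /\
   ex_series (fun k : nat =>
     sin (2 * PI * u)
       / (cosh (2 * INR (S k) * PI ^ 2 * t) + cos (2 * PI * u))) /\
   Derive (fun v => theta2 v t) u / theta2 u t =
     - PI * tan (PI * u)
     - 2 * PI * Series (fun k : nat =>
       sin (2 * PI * u)
         / (cosh (2 * INR (S k) * PI ^ 2 * t) + cos (2 * PI * u)))).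
Proof.
intros t u ht hu.
assert (hc := nome_rate_pos t ht).
assert (hy0 : forall k, PI ^ 2 * t * (INR (2 * k + 0) + 1)
                        = 2 * INR k * PI ^ 2 * t + PI ^ 2 * t).
{ intros k. rewrite plus_INR, mult_INR. change (INR 2) with 2.
  change (INR 0) with 0. ring. }
assert (hy1 : forall k, PI ^ 2 * t * (INR (2 * k + 1) + 1)
                        = 2 * INR (S k) * PI ^ 2 * t).
{ intros k. rewrite plus_INR, mult_INR, (S_INR k). change (INR 2) with 2.
  change (INR 1) with 1. ring. }
assert (hcosPI : cos (2 * - (PI / 2)) = -1).
{ replace (2 * - (PI / 2)) with (- PI) by field. now rewrite cos_neg, cos_PI. }
assert (hsinPI : sin (2 * - (PI / 2)) = 0).
{ replace (2 * - (PI / 2)) with (- PI) by field. rewrite sin_neg, sin_PI; ring. }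
assert (hPI := PI_RGT_0).
split; [|split; [|split]].
- rewrite <- (Rplus_0_l (2 * Series _)).
  eapply (log_derivative_rescale (fun v => theta4 v t) u _ _ _ (- PI) 2
    (PI * (INR 0 * tan (INR 0 * (PI * u + PI / 2))))); [lra| | | ring | simpl; ring].
  + apply (log_derivative_of_shift (fun v => theta4 v t) (PI ^ 2 * t) 0 (PI / 2));
      [exact hc | lia | |].
    * intros v; now apply theta4_eq.
    * simpl. rewrite Rmult_0_l, cos_0. lra.
  + intros k; cbv beta; rewrite hy0, log_term_half_shift.
    * unfold Rdiv; ring.
    * replace (2 * (PI / 2)) with PI by field. apply cos_PI.
    * replace (2 * (PI / 2)) with PI by field. apply sin_PI.
- rewrite <- (Rplus_0_l (- 2 * Series _)).
  eapply (log_derivative_rescale (fun v => theta3 v t) u _ _ _ PI (-2)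
    (PI * (INR 0 * tan (INR 0 * (PI * u + 0))))); [lra| | | ring | simpl; ring].
  + apply (log_derivative_of_shift (fun v => theta3 v t) (PI ^ 2 * t) 0 0);
      [exact hc | lia | |].
    * intros v; now apply theta3_eq.
    * simpl. rewrite Rmult_0_l, cos_0. lra.
  + intros k; cbv beta; rewrite hy0, log_term_shift.
    * unfold Rdiv; ring.
    * rewrite Rmult_0_r; apply cos_0.
    * rewrite Rmult_0_r; apply sin_0.
- assert (hsin : sin (PI * u) <> 0) by (apply Rgt_not_eq, sin_gt_0; nra).
  assert (hcs : cos (PI * u + - (PI / 2)) = sin (PI * u))
    by (rewrite cos_sin; f_equal; field).
  eapply (log_derivative_rescale (fun v => theta1 v t) u _ _ _ (-1) (2 * PI)
    (PI * (INR 1 * tan (INR 1 * (PI * u + - (PI / 2)))))); [lra| | | ring |].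
  + apply (log_derivative_of_shift (fun v => theta1 v t) (PI ^ 2 * t) 1 (- (PI / 2)));
      [exact hc | lia | |].
    * intros v; apply theta1_eq.
    * simpl. now rewrite Rmult_1_l, hcs.
  + intros k; cbv beta; rewrite hy1, log_term_half_shift by assumption. ring.
  + simpl. rewrite !Rmult_1_l. unfold tan, cot. rewrite hcs.
    rewrite sin_plus, sin_neg, cos_neg, sin_PI2, cos_PI2. field. exact hsin.
- intros hu2.
  assert (hcos : cos (PI * u) <> 0).
  { intros h. destruct (Rtotal_order u (1 / 2)) as [hl|[hl|hl]]; [|easy|].
    - assert (0 < cos (PI * u)) by (apply cos_gt_0; nra). lra.
    - assert (cos (PI * u) < 0) by (apply cos_lt_0; nra). lra. }
  unfold Rminus at 1. rewrite Ropp_mult_distr_l.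
  eapply (log_derivative_rescale (fun v => theta2 v t) u _ _ _ 1 (- (2 * PI))
    (PI * (INR 1 * tan (INR 1 * (PI * u + 0))))); [lra| | | ring |].
  + apply (log_derivative_of_shift (fun v => theta2 v t) (PI ^ 2 * t) 1 0);
      [exact hc | lia | |].
    * intros v; apply theta2_eq.
    * simpl. now rewrite Rmult_1_l, Rplus_0_r.
  + intros k; cbv beta; rewrite hy1, log_term_shift; [ring | |].
    * rewrite Rmult_0_r; apply cos_0.
    * rewrite Rmult_0_r; apply sin_0.
  + simpl. rewrite !Rmult_1_l, Rplus_0_r. ring.
Qed.
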